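(* Let $F$ be a finite extension of $\mathbb{Q}_p$, let $n\in\mathbb{N}_{>0}$, and let $\pi_1,\dots,\pi_n$ be irreducible admissible representations of $G=\mathrm{GL}_2(F)$ over $\overline{\mathbb{F}}_p$, each of which is either a principal series or a special series. Then $$\operatorname{Hom}_{G}\Big(\bigotimes_{i=1}^n\pi_i,\mathbf{1}\Big)=0.$$
   Context: $p$ is a prime number. All representations are over $k=\overline{\mathbb{F}}_p$; tensor products are over $k$ with the diagonal group action; $\mathbf{1}$ is the trivial one-dimensional representation; $\operatorname{Hom}_G$ denotes the space of $k$-linear $G$-equivariant maps. Let $B\subset G$ be the subgroup of upper triangular matrices. For smooth characters $\theta_1,\theta_2:F^*\to k^*$, let $\theta_1\otimes\theta_2$ be the character $\begin{pmatrix} x & z\\ 0& y\end{pmatrix}\mapsto\theta_1(x)\theta_2(y)$ of $B$, and let $\operatorname{Ind}_B^G(\theta_1\otimes\theta_2)$ be the space of functions $f:G\to k$ with $f(bg)=(\theta_1\otimes\theta_2)(b)f(g)$ for all $b\in B$, $g\in G$, that are right-invariant under some open subgroup of $G$ (depending on $f$), with $G$ acting by right translation, $(g\cdot f)(g')=f(g'g)$. A principal series is a representation $\operatorname{Ind}_B^G(\theta_1\otimes\theta_2)$ with $\theta_1\neq\theta_2$. A special series is a representation $\mathrm{Sp}\otimes(\theta\circ\det)$ with $\theta:F^*\to k^*$ a smooth character, where $\mathrm{Sp}$ is defined by the exact sequence $0\to\mathbf{1}\to\operatorname{Ind}_B^G\mathbf{1}\to\mathrm{Sp}\to0$ (the image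 of $\mathbf{1}$ being the constant functions). *)

(* Defs.v *)
From HB Require Import structures.
From mathcomp Require Import all_boot all_order all_algebra.
From mathcomp Require Import all_fingroup all_solvable all_field.
From mathcomp Require Import generic_quotient ring_quotient.
From mathcomp Require Import boolp classical_sets functions cardinality.
From mathcomp Require Import ring.

Set Implicit Arguments.
Unset Strict Implicit.
Unset Printing Implicit Defensive.

Import GRing.Theory.
Local Open Scope quotient_scope.
Local Open Scope classical_set_scope.
Local Open Scope ring_scope.

Section PadicIntegers.
Variables (p : nat) (p_pr : prime p).

(* An element of the inverse limit of the Z/p^n, each component being given by
   its representative in [0, p^n[; the reduction mod p^n of the component of
   index n.+1 is the component of index n (in particular it is < p^n). *)
Record padic_int (p_pr : prime p) := PadicInt {
  pcomp :> nat -> nat;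
  _ : `[< forall n, pcomp n = (pcomp n.+1 %% p ^ n)%N >] }.

Local Notation Zp := (padic_int p_pr).

HB.instance Definition _ := [isSub for @pcomp p_pr].
HB.instance Definition _ := [Choice of Zp by <:].

Lemma pcompS (x : Zp) n : (x n = x n.+1 %% p ^ n)%N.
Proof. by case: x => x /= /asboolP. Qed.

Lemma pcomp_mod (x : Zp) m n : (m <= n)%N -> x m = (x n %% p ^ m)%N.
Proof.
elim: n => [|n IHn]; first by rewrite leqn0 => /eqP->; rewrite [LHS]pcompS !modn1.
rewrite leq_eqVlt ltnS => /orP[/eqP->|le_mn].
  by rewrite pcompS modn_mod.
by rewrite IHn // [x n]pcompS modn_dvdm // dvdn_exp2l.
Qed.

Lemma pcomp_small (x : Zp) n : (x n %% p ^ n = x n)%N.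
Proof. by rewrite -pcomp_mod. Qed.

Lemma padic_eqP (x y : Zp) : x =1 y -> x = y.
Proof. by move=> xy; apply/val_inj/funext. Qed.

Let dvd_pS n : (p ^ n %| p ^ n.+1)%N. Proof. by rewrite dvdn_exp2l. Qed.

Lemma padic_of_subproof (u : nat -> nat) :
  (forall n, u n = u n.+1 %[mod p ^ n])%N ->
  `[< forall n, (u n %% p ^ n = u n.+1 %% p ^ n.+1 %% p ^ n)%N >].
Proof. by move=> Hu; apply/asboolP => n; rewrite modn_dvdm. Qed.

Definition padic_of (u : nat -> nat)
    (Hu : (forall n, u n = u n.+1 %[mod p ^ n])%N) : Zp :=
  @PadicInt p_pr _ (padic_of_subproof Hu).

Fact padic_nat_subproof (k : nat) n : (k = k %[mod p ^ n])%N. Proof. by []. Qed.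
Definition padic_nat k := padic_of (padic_nat_subproof k).

Fact padic_add_subproof (x y : Zp) n :
  (x n + y n = x n.+1 + y n.+1 %[mod p ^ n])%N.
Proof. by rewrite (pcompS x n) (pcompS y n) modnDm. Qed.
Definition padic_add x y := padic_of (padic_add_subproof x y).

Fact padic_mul_subproof (x y : Zp) n :
  (x n * y n = x n.+1 * y n.+1 %[mod p ^ n])%N.
Proof. by rewrite (pcompS x n) (pcompS y n) modnMm. Qed.
Definition padic_mul x y := padic_of (padic_mul_subproof x y).

Fact padic_opp_subproof (x : Zp) n :
  ((p ^ n).-1 * x n = (p ^ n.+1).-1 * x n.+1 %[mod p ^ n])%N.
Proof.
rewrite (pcompS x n) modnMmr.
have pn0 m : (0 < p ^ m)%N by rewrite expn_gt0 prime_gt0.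
apply/eqP; rewrite -(eqn_modDr (x n.+1)) -!mulSnr !prednK //.
by rewrite modnMr -modnMml (eqP (dvd_pS n)) mul0n mod0n.
Qed.
Definition padic_opp x := padic_of (padic_opp_subproof x).

Fact padic_addA : associative padic_add.
Proof. by move=> x y z; apply/padic_eqP => n /=; rewrite modnDmr modnDml addnA. Qed.
Fact padic_addC : commutative padic_add.
Proof. by move=> x y; apply/padic_eqP => n /=; rewrite addnC. Qed.
Fact padic_add0 : left_id (padic_nat 0) padic_add.
Proof. by move=> x; apply/padic_eqP => n /=; rewrite modnDml pcomp_small. Qed.
Fact padic_addN : left_inverse (padic_nat 0) padic_opp padic_add.
Proof.
move=> x; apply/padic_eqP => n /=; rewrite modnDml -mulSnr prednK ?modnMr ?mod0n//.
by rewrite expn_gt0 prime_gt0.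
Qed.

HB.instance Definition _ :=
  GRing.isZmodule.Build Zp padic_addA padic_addC padic_add0 padic_addN.

Fact padic_mulA : associative padic_mul.
Proof. by move=> x y z; apply/padic_eqP => n /=; rewrite modnMmr modnMml mulnA. Qed.
Fact padic_mulC : commutative padic_mul.
Proof. by move=> x y; apply/padic_eqP => n /=; rewrite mulnC. Qed.
Fact padic_mul1 : left_id (padic_nat 1) padic_mul.
Proof. by move=> x; apply/padic_eqP => n /=; rewrite modnMml mul1n pcomp_small. Qed.
Fact padic_mulD : left_distributive padic_mul padic_add.
Proof.
by move=> x y z; apply/padic_eqP => n /=; rewrite modnMml modnDml modnDmr mulnDl.
Qed.
Fact padic_1_neq0 : padic_nat 1 != 0.
Proof.
apply/eqP => /(congr1 (fun x : Zp => x 1%N)) /=.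
by rewrite expn1 mod0n modn_small ?prime_gt1.
Qed.

HB.instance Definition _ := GRing.Zmodule_isComNzRing.Build Zp
  padic_mulA padic_mulC padic_mul1 padic_mulD padic_1_neq0.

Definition padic_unit : pred Zp := fun x => `[< exists y : Zp, y * x = 1 >].
Definition padic_inv (x : Zp) : Zp := xget x [set y : Zp | y * x = 1].

Fact padic_mulV : {in padic_unit, left_inverse 1 padic_inv *%R}.
Proof.
by move=> x /asboolP[y yx1]; rewrite /padic_inv; case: xgetP => // /(_ y) /(_ yx1).
Qed.
Fact padic_unitP (x y : Zp) : y * x = 1 -> padic_unit x.
Proof. by move=> yx1; apply/asboolP; exists y. Qed.
Fact padic_inv_out : {in [predC padic_unit], padic_inv =1 id}.
Proof.
move=> x /negP nux; rewrite /padic_inv; case: xgetP => // y _ yx1.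
by case: nux; apply: padic_unitP yx1.
Qed.

HB.instance Definition _ := GRing.ComNzRing_hasMulInverse.Build Zp
  padic_mulV padic_unitP padic_inv_out.

Lemma padic_neq0P (x : Zp) : x != 0 -> exists n, x n != 0%N.
Proof.
move=> x0; apply/not_existsP => xn0; case/eqP: x0; apply/padic_eqP => n /=.
by rewrite mod0n; apply/eqP; have /negP := xn0 n; rewrite negbK.
Qed.

Lemma padic_natE (k : nat) : k%:R = padic_nat k :> Zp.
Proof.
elim: k => [|k IHk]; first by [].
by rewrite -addn1 natrD IHk; apply/padic_eqP => n /=; rewrite modnDm.
Qed.

(* Up to a unit, every nonzero element of Zp is a power of p. *)
Lemma padic_dvd_expp (x : Zp) : x != 0 -> exists v (y : Zp), y * x = p%:R ^+ v.
Proof.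
move=> /padic_neq0P exn; case: (ex_minnP exn) => -[|v] xv0 v_min.
  by move: xv0; rewrite -(pcomp_small x 0) modn1.
have xv : x v = 0%N by apply/eqP/negPn/negP => /v_min; rewrite ltnn.
pose U n := (x (n + v.+1) %/ p ^ v)%N.
have pv0 m : (0 < p ^ m)%N by rewrite expn_gt0 prime_gt0.
have xU n : x (n + v.+1)%N = (U n * p ^ v)%N.
  rewrite /U divnK // /dvdn -pcomp_mod ?xv //.
  by rewrite (leq_trans _ (leq_addl _ _)).
have Ucop n : coprime (U n) p.
  rewrite coprime_sym prime_coprime //; apply: contraNN xv0 => pU.
  by rewrite (@pcomp_mod x v.+1 (n + v.+1)) ?leq_addl // xU
    expnS -/(dvdn _ _) dvdn_pmul2r.
have US n : (U n = U n.+1 %[mod p ^ n])%N.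
  apply/eqP; rewrite -(@eqn_pmul2r (p ^ v)) // !muln_modl // -!xU -expnD.
  apply/eqP; rewrite [x (n + v.+1)%N](@pcomp_mod x _ (n.+1 + v.+1)) ?leq_add2r //.
  by rewrite modn_dvdm // dvdn_exp2l // leq_add2l.
pose Y n := (U n ^ (totient (p ^ n)).-1)%N.
have UY n : (U n * Y n = 1 %[mod p ^ n])%N.
  rewrite -expnS prednK ?totient_gt0 // Euler_exp_totient //.
  exact: coprimeXr.
have YS n : (Y n = Y n.+1 %[mod p ^ n])%N.
  have UYS : (U n.+1 * Y n.+1 = 1 %[mod p ^ n])%N.
    by have := congr1 (modn^~ (p ^ n)%N) (UY n.+1); rewrite /= !modn_dvdm.
  rewrite -[Y n]muln1 -modnMmr -UYS modnMmr mulnA -modnMml.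
  by rewrite -(modnMmr (Y n) (U n.+1)) -US modnMmr [(Y n * U n)%N]mulnC UY modnMml mul1n.
exists v, (padic_of YS); rewrite -natrX padic_natE.
apply/padic_eqP => n /=.
rewrite modnMml (@pcomp_mod x n (n + v.+1)) ?leq_addr // modnMmr xU mulnA.
by rewrite -modnMml [(Y n * _)%N]mulnC UY modnMml mul1n.
Qed.

Lemma padic_expp_neq0 m : (p%:R : Zp) ^+ m != 0.
Proof.
rewrite -natrX padic_natE; apply/eqP => /(congr1 (fun x : Zp => x m.+1)) /=.
rewrite mod0n modn_small ?ltn_exp2l ?prime_gt1 // => /eqP.
by rewrite expn_eq0 -leqn0 leqNgt prime_gt0.
Qed.

Fact padic_integral (x y : Zp) : x * y = 0 -> (x == 0) || (y == 0).
Proof.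
move=> xy0; apply/norP => -[].
move=> /padic_dvd_expp[v [x' x'x]] /padic_dvd_expp[w [y' y'y]].
have /negP[] := padic_expp_neq0 (v + w).
by rewrite exprD -x'x -y'y mulrACA xy0 mulr0.
Qed.

HB.instance Definition _ := GRing.ComUnitRing_isIntegral.Build Zp padic_integral.

End PadicIntegers.

Lemma fracE (R : idomainType) (c : {fraction R}) :
  exists a b : R, b != 0 /\ c * FracField.tofrac b = FracField.tofrac a.
Proof.
exists (frac (repr c)).1, (frac (repr c)).2; split; first exact: denom_ratioP.
have cE : c = \pi_(FracField.type R) (repr c) by rewrite reprK.
move: (repr c) cE => r ->; have r20 := denom_ratioP r.
unlock FracField.tofrac; rewrite -[LHS]FracField.pi_mul; apply/eqmodP => /=.
rewrite FracField.equivfE /FracField.mulf.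
rewrite !numden_Ratio ?oner_neq0 ?mulf_neq0 ?oner_neq0 ?mulr1 //.
by rewrite mulrC.
Qed.

Definition padic (p : nat) (p_pr : prime p) : fieldType := {fraction padic_int p_pr}.

Definition padic_ball (p : nat) (p_pr : prime p) (m : nat) : set (padic p_pr) :=
  [set x : padic p_pr| exists z : padic_int p_pr, x = FracField.tofrac (p%:R ^+ m * z)].
Arguments padic_ball {p} p_pr m _.

Section PadicBall.
Variables (p : nat) (p_pr : prime p).
Local Notation Qp := (padic p_pr).
Local Notation ball := (padic_ball p_pr).

Lemma padic_ball0 m : ball m 0.
Proof. by exists 0; rewrite mulr0 tofrac0. Qed.

Lemma padic_ballD m x y : ball m x -> ball m y -> ball m (x + y).
Proof. by move=> [a ->] [b ->]; exists (a + b); rewrite mulrDr tofracD. Qed.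

Lemma padic_ballS m n x : (m <= n)%N -> ball n x -> ball m x.
Proof.
move=> le_mn [a ->]; exists (p%:R ^+ (n - m) * a).
by rewrite mulrA -exprD subnKC.
Qed.

Lemma padic_ballM (c : Qp) m : exists n, forall x, ball n x -> ball m (c * x).
Proof.
have [a [b [b0 cb]]] := fracE c.
have [v [y yb]] := padic_dvd_expp b0.
exists (v + m)%N => x [z ->]; exists (y * a * z).
rewrite exprD -yb !tofracM -cb.
have ringE (K : fieldType) (u1 u2 u3 u4 u5 : K) :
  u1 * (u2 * u3 * u4 * u5) = u4 * (u2 * (u1 * u3) * u5) by ring.
exact: ringE.
Qed.

End PadicBall.

(* The topology of a finite extension F of Qp: that of F as a finite dimensional
   vector space over Qp. The sets [ext_ball m], of elements whose coordinates in
   a Qp-basis lie in p^m Zp, form a basis of neighbourhoods of 0. *)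
Section ExtensionBall.
Variables (p : nat) (p_pr : prime p) (F : fieldExtType (padic p_pr)).

Definition ext_ball (m : nat) : set F :=
  [set x : F | forall i, padic_ball p_pr m (coord (vbasis {:F}) i x)].

Definition mx_ball (m : nat) : set 'M[F]_2 :=
  [set A : 'M[F]_2 | forall i j, ext_ball m (A i j)].

Lemma ext_ball0 m : ext_ball m 0.
Proof. by move=> i; rewrite linear0; apply: padic_ball0. Qed.

Lemma ext_ballD m x y : ext_ball m x -> ext_ball m y -> ext_ball m (x + y).
Proof. by move=> xm ym i; rewrite linearD; apply: padic_ballD (xm i) (ym i). Qed.

Lemma ext_ballS m n x : (m <= n)%N -> ext_ball n x -> ext_ball m x.
Proof. by move=> le_mn xn i; apply: padic_ballS (xn i). Qed.

Lemma fin_bound (I : finType) (P : I -> nat -> Prop) :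
  (forall i, exists n, P i n) -> (forall i m n, (m <= n)%N -> P i m -> P i n) ->
  exists n, forall i, P i n.
Proof.
move=> /choice[f Pf] Pmono; exists (\max_i f i) => i.
by apply: Pmono (Pf i); apply: leq_bigmax.
Qed.

Lemma ext_ball_sum (I : finType) (f : I -> F) m :
  (forall i, ext_ball m (f i)) -> ext_ball m (\sum_i f i).
Proof.
move=> Hf; apply: (big_ind (ext_ball m)) => [|y z|i _]; last exact: Hf.
  exact: ext_ball0.
exact: ext_ballD.
Qed.

Lemma ext_ballM (c : F) m : exists n, forall x, ext_ball n x -> ext_ball m (c * x).
Proof.
pose a (q : 'I_(\dim {:F}) * 'I_(\dim {:F})) :=
  coord (vbasis {:F}) q.2 (c * (vbasis {:F})`_q.1).
have [|q n n' le_nn' H x xn|N HN] := @fin_bound _ (fun q n => forall x,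
    padic_ball p_pr n x -> padic_ball p_pr m (a q * x)).
- by move=> q; apply: padic_ballM.
- by apply: H; apply: padic_ballS xn.
exists N => x xN j.
rewrite (coord_vbasis (memvf x)) mulr_sumr linear_sum.
apply: big_ind => [|y z|i _]; [exact: padic_ball0 | exact: padic_ballD |].
rewrite -scalerAr linearZ.
by rewrite -[X in padic_ball _ _ X]/(_ * a (i, j)) mulrC; apply: HN; apply: xN.
Qed.

Lemma mx_ballS m n A : (m <= n)%N -> mx_ball n A -> mx_ball m A.
Proof. by move=> le_mn An i j; apply: ext_ballS (An i j). Qed.

Lemma mx_ballM (A B : 'M[F]_2) m :
  exists n, forall X, mx_ball n X -> mx_ball m (A *m X *m B).
Proof.
pose P n := forall (i j k l : 'I_2) x, ext_ball n x -> ext_ball m (A i j * x * B k l).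
suff [n Pn] : exists n, P n.
  exists n => X Xn i l; rewrite mxE; apply: ext_ball_sum => k.
  by rewrite mxE mulr_suml; apply: ext_ball_sum => j; apply: Pn.
have [[[[i j] k] l]|[[[i j] k] l] n n' le_nn' /= H x xn|n Hn] := @fin_bound
   ('I_2 * 'I_2 * 'I_2 * 'I_2)%type (fun q n => forall x, ext_ball n x ->
     ext_ball m (A q.1.1.1 q.1.1.2 * x * B q.1.2 q.2)) _ _ => /=.
- have [n Hn] := ext_ballM (A i j * B k l) m.
  by exists n => x /Hn; rewrite mulrAC.
- by apply: H; apply: ext_ballS xn.
- by exists n => i j k l x xn; have := Hn (i, j, k, l) x xn.
Qed.

End ExtensionBall.

Section UnitGroup.
Variable R : unitRingType.

Record units := Units { uval :> R; uvalP : uval \is a GRing.unit }.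
HB.instance Definition _ := [isSub for uval].
HB.instance Definition _ := [Choice of units by <:].

Implicit Types x y z : units.
Definition units_one : units := Units (unitr1 R).
Fact units_inv_subproof x : (uval x)^-1 \is a GRing.unit.
Proof. by rewrite unitrV uvalP. Qed.
Definition units_inv x := Units (units_inv_subproof x).
Fact units_mul_subproof x y : uval x * uval y \is a GRing.unit.
Proof. by rewrite unitrMl ?uvalP. Qed.
Definition units_mul x y := Units (units_mul_subproof x y).

Fact units_mulA : associative units_mul.
Proof. by move=> x y z; apply/val_inj/mulrA. Qed.
Fact units_mul1 : left_id units_one units_mul.
Proof. by move=> x; apply/val_inj/mul1r. Qed.
Fact units_mulr1 : right_id units_one units_mul.
Proof. by move=> x; apply/val_inj/mulr1. Qed.
Fact units_mulV : left_inverse units_one units_inv units_mul.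
Proof. by move=> x; apply/val_inj/mulVr/uvalP. Qed.
Fact units_mulrV : right_inverse units_one units_inv units_mul.
Proof. by move=> x; apply/val_inj/mulrV/uvalP. Qed.
HB.instance Definition _ := isGroup.Build units
  units_mulA units_mul1 units_mulr1 units_mulV units_mulrV.

(* The topology induced on the group of units by the topology of R for which
   (N m)_m is a basis of neighbourhoods of 0. *)
Definition units_open (N : nat -> set R) (U : set units) :=
  forall x, U x -> exists m, forall y, N m (uval y - uval x) -> U y.

End UnitGroup.

Definition open_subgroup (G : groupType) (opn : set G -> Prop) (K : set G) :=
  [/\ K 1%g, forall g h, K g -> K h -> K (g * h)%g, forall g, K g -> K (g^-1)%g
    & opn K].

Record rep (k : fieldType) (G : groupType) := Rep {
  rep_space :> lmodType k;
  act : G -> rep_space -> rep_space;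
  act_linear : forall g, linear (act g);
  act1 : forall v, act 1%g v = v;
  actM : forall g h v, act (g * h)%g v = act g (act h v) }.

Arguments act {k G} r g v.

Section Representations.
Variables (k : fieldType) (G : groupType).
Implicit Types rho sigma : rep k G.

Definition equivariant rho sigma (f : rho -> sigma) :=
  forall g v, f (act rho g v) = act sigma g (f v).

Definition isomorphic rho sigma :=
  exists f : {linear rho -> sigma}, bijective f /\ equivariant f.

Definition stable rho (S : {pred rho}) :=
  forall g v, v \in S -> act rho g v \in S.

Definition irreducible rho :=
  (exists v : rho, v != 0) /\
  forall S : {pred rho}, submod_closed S -> stable S ->
    (forall v, v \in S -> v = 0) \/ (forall v, v \in S).

Definition fixed_by rho (K : set G) (v : rho) := forall g, K g -> act rho g v = v.

Definition admissible (opn : set G -> Prop) rho :=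
  (forall v : rho, exists K, open_subgroup opn K /\ fixed_by K v) /\
  (forall K, open_subgroup opn K -> exists (d : nat) (e : 'I_d -> rho),
     (forall i, fixed_by K (e i)) /\
     (forall v, fixed_by K v -> exists c : 'I_d -> k, v = \sum_i c i *: e i)).

Fact triv_rep_linear (g : G) : linear (fun v : k^o => v). Proof. by []. Qed.
Definition triv_rep : rep k G :=
  @Rep k G k^o _ triv_rep_linear (fun=> erefl) (fun _ _ _ => erefl).

Section CharacterRep.
Variable chi : {multiplicative G -> units k}.
Fact char_rep_linear g : linear (fun v : k^o => uval (chi g) *: v).
Proof. by move=> a u v; rewrite scalerDr !scalerA mulrC. Qed.
Fact char_rep1 (v : k^o) : uval (chi 1%g) *: v = v.
Proof.
suff -> : chi 1%g = 1%g by rewrite scale1r.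
by apply: (@mulgI _ (chi 1%g)); rewrite -gmulfM !mulg1.
Qed.
Fact char_repM g h (v : k^o) :
  uval (chi (g * h)%g) *: v = uval (chi g) *: (uval (chi h) *: v).
Proof. by rewrite gmulfM scalerA. Qed.
Definition char_rep : rep k G := Rep char_rep_linear char_rep1 char_repM.
End CharacterRep.

End Representations.

Section SubModule.
Variables (k : fieldType) (V : lmodType k) (S : submodClosed V).
Record submod := Submod { submod_val :> V; submodP : submod_val \in S }.
HB.instance Definition _ := [isSub for submod_val].
HB.instance Definition _ := [Choice of submod by <:].
HB.instance Definition _ := [SubChoice_isSubLmodule of submod by <:].
End SubModule.

Section QuotModule.
Variables (k : fieldType) (V : lmodType k) (S : submodClosed V).

Definition zmod_pred : {pred V} := S.
HB.instance Definition _ := GRing.isZmodClosed.Build V zmod_pred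
  (GRing.submod_closedB (submodClosedP S)).
Local Notation Q := (Quotient.quot zmod_pred).

Definition quot_scale (a : k) (x : Q) : Q := \pi_Q (a *: repr x).

Lemma quot_eqP (u v : V) : \pi_Q u = \pi_Q v <-> u - v \in S.
Proof.
rewrite -[u - v \in S]/(u - v \in zmod_pred) Quotient.idealrBE.
by split=> [->|/eqP].
Qed.

Lemma pi_quotD (u v : V) : \pi_Q (u + v) = \pi_Q u + \pi_Q v.
Proof. by rewrite !piE. Qed.

Lemma pi_quot_scale a v : quot_scale a (\pi_Q v) = \pi_Q (a *: v).
Proof. by apply/quot_eqP; rewrite -scalerBr rpredZ //; apply/quot_eqP; rewrite reprK. Qed.

Fact quot_scaleA a b x : quot_scale a (quot_scale b x) = quot_scale (a * b) x.
Proof. by elim/quotW: x => v; rewrite (pi_quot_scale b v) (pi_quot_scale a) (pi_quot_scale _ v) scalerA. Qed.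
Fact quot_scale1 : left_id 1 quot_scale.
Proof. by elim/quotW=> v; rewrite (pi_quot_scale 1 v) scale1r. Qed.
Fact quot_scaleDr : right_distributive quot_scale +%R.
Proof.
move=> a; elim/quotW=> u; elim/quotW=> v.
by rewrite -pi_quotD (pi_quot_scale a u) (pi_quot_scale a v) -pi_quotD (pi_quot_scale a) scalerDr.
Qed.
Fact quot_scaleDl x : {morph quot_scale^~ x : a b / a + b}.
Proof.
by elim/quotW: x => v a b; rewrite (pi_quot_scale a v) (pi_quot_scale b v) -pi_quotD (pi_quot_scale _ v) scalerDl.
Qed.

Definition quotmod := Q.
HB.instance Definition _ := GRing.Zmodule.on quotmod.
HB.instance Definition _ := GRing.Zmodule_isLmodule.Build k quotmod
  quot_scaleA quot_scale1 quot_scaleDr quot_scaleDl.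

Definition quotpi (v : V) : quotmod := \pi_Q v.
End QuotModule.

Section SubQuotRep.
Variables (k : fieldType) (G : groupType) (rho : rep k G).
Variables (S : submodClosed rho) (S_stable : stable S).

Definition sub_act g (v : submod S) : submod S := Submod (S_stable g (submodP v)).
Fact sub_act_linear g : linear (sub_act g).
Proof. by move=> a u v; apply: val_inj; rewrite /= act_linear. Qed.
Fact sub_act1 v : sub_act 1%g v = v.
Proof. by apply: val_inj; rewrite /= act1. Qed.
Fact sub_actM g h v : sub_act (g * h)%g v = sub_act g (sub_act h v).
Proof. by apply: val_inj; rewrite /= actM. Qed.
Definition sub_rep : rep k G := Rep sub_act_linear sub_act1 sub_actM.

Definition quot_act g (x : quotmod S) : quotmod S := quotpi S (act rho g (repr x)).
Lemma quot_act_pi g v : quot_act g (quotpi S v) = quotpi S (act rho g v).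
Proof.
have actB a b : act rho g (a - b) = act rho g a - act rho g b.
  by rewrite -[- b]scaleN1r addrC act_linear scaleN1r addrC.
by apply/quot_eqP; rewrite -actB; apply/S_stable/quot_eqP; rewrite reprK.
Qed.
Lemma quotpi_linear : linear (quotpi S).
Proof. by move=> a u v; rewrite /quotpi pi_quotD -pi_quot_scale. Qed.
Lemma quotpi_surj (x : quotmod S) : exists v, x = quotpi S v.
Proof. by exists (repr x); rewrite /quotpi reprK. Qed.
Fact quot_act_linear g : linear (quot_act g).
Proof.
move=> a x y; have [u ->] := quotpi_surj x; have [v ->] := quotpi_surj y.
rewrite -quotpi_linear (quot_act_pi g u) (quot_act_pi g v) quot_act_pi.
by rewrite act_linear quotpi_linear.
Qed.
Fact quot_act1 x : quot_act 1%g x = x.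
Proof. by have [v ->] := quotpi_surj x; rewrite quot_act_pi act1. Qed.
Fact quot_actM g h x : quot_act (g * h)%g x = quot_act g (quot_act h x).
Proof.
have [v ->] := quotpi_surj x.
by rewrite (quot_act_pi h v) (quot_act_pi g) (quot_act_pi _ v) actM.
Qed.
Definition quot_rep : rep k G := Rep quot_act_linear quot_act1 quot_actM.
End SubQuotRep.

Section Span.
Variables (k : fieldType) (V : lmodType k) (P : set V).

Definition span_pred : {pred V} := fun v =>
  `[< forall S : {pred V}, submod_closed S -> (forall u, P u -> u \in S) -> v \in S >].

Fact span_submod : subsemimod_closed span_pred.
Proof.
split; first split.
- by apply/asboolP => S Sc _; case: Sc.
- move=> u v /asboolP Su /asboolP Sv; apply/asboolP => S Sc PS.
  exact: (GRing.submod_closed_semi Sc).1.2 (Su S Sc PS) (Sv S Sc PS).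
- move=> a v /asboolP Sv; apply/asboolP => S Sc PS.
  exact: (GRing.submod_closed_semi Sc).2 (Sv S Sc PS).
Qed.
HB.instance Definition _ := GRing.isSubmodClosed.Build k V span_pred span_submod.

Lemma span_sub v : P v -> v \in span_pred.
Proof. by move=> Pv; apply/asboolP => S _; apply. Qed.
End Span.

Section Tensor.
Variables (k : fieldType) (G : groupType) (I : finType) (rho : I -> rep k G).

Local Notation X := (forall i, rho i).

Definition pointwise_act (g : G) (x : X) : X := fun i => act (rho i) g (x i).

(* The free module on X, realized as finitely supported functions X -> k;
   g maps the basis vector [delta x] to [delta (g x)]. *)
Definition perm_act (g : G) (f : X -> k^o) : X -> k^o := fun x => f (pointwise_act g^-1%g x).

Lemma pointwise_act1 x : pointwise_act 1%g x = x.
Proof. by apply: functional_extensionality_dep => i; apply: act1. Qed.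
Lemma pointwise_actM g h x :
  pointwise_act (g * h)%g x = pointwise_act g (pointwise_act h x).
Proof. by apply: functional_extensionality_dep => i; apply: actM. Qed.
Fact perm_act_linear g : linear (perm_act g).
Proof. by []. Qed.
Fact perm_act1 f : perm_act 1%g f = f.
Proof. by apply/funext => x; rewrite /perm_act invg1 pointwise_act1. Qed.
Fact perm_actM g h f : perm_act (g * h)%g f = perm_act g (perm_act h f).
Proof. by apply/funext => x; rewrite /perm_act invMg pointwise_actM. Qed.
Definition perm_rep : rep k G := Rep perm_act_linear perm_act1 perm_actM.

Definition finsupp_pred : {pred perm_rep} := fun f : X -> k^o =>
  `[< finite_set [set x | f x != 0] >].

Fact finsupp_submod : subsemimod_closed finsupp_pred.
Proof.
split; first split.
- apply/asboolP; rewrite (_ : [set x | _] = set0) ?finite_set0 //.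
  by apply/seteqP; split=> x //=; rewrite eqxx.
- move=> f g /asboolP Hf /asboolP Hg; apply/asboolP.
  apply: (@sub_finite_set _ _ ([set x | f x != 0] `|` [set x | g x != 0])%classic).
    move=> x /= fg; have [fx|fx] := eqVneq (f x) 0; last by left.
    by right; apply: contraNneq fg => gx; rewrite fctE fx gx addr0.
  by rewrite finite_setU.
- move=> a f /asboolP Hf; apply/asboolP; apply: sub_finite_set Hf => x /=.
  by apply: contraNneq => fx; rewrite fctE fx scaler0.
Qed.
HB.instance Definition _ :=
  GRing.isSubmodClosed.Build k perm_rep finsupp_pred finsupp_submod.

Fact finsupp_stable : @stable _ _ perm_rep finsupp_pred.
Proof.
move=> g f /asboolP Hf; apply/asboolP.
apply: (@sub_finite_set _ _ (pointwise_act g @` [set x | f x != 0])%classic).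
  move=> x fx; exists (pointwise_act g^-1%g x) => //.
  by rewrite -pointwise_actM mulgV pointwise_act1.
exact: finite_image.
Qed.

Definition free_rep : rep k G := sub_rep finsupp_stable.

Definition delta_fun (x : X) : X -> k^o := fun y => (`[< y = x >])%:R.
Fact delta_finsupp x : (delta_fun x : perm_rep) \in finsupp_pred.
Proof.
apply/asboolP; apply: (@sub_finite_set _ _ [set x]); last exact: finite_set1.
by move=> y /=; rewrite /delta_fun; case: asboolP => //; rewrite eqxx.
Qed.
Definition delta (x : X) : free_rep := Submod (delta_finsupp x).

Lemma act_delta g x : act free_rep g (delta x) = delta (pointwise_act g x).
Proof.
apply: val_inj; apply/funext => y /=; rewrite /perm_act /delta_fun; congr (_%:R).
congr nat_of_bool; apply: asbool_equiv_eq; split=> [<-|->].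
  by rewrite -pointwise_actM mulgV pointwise_act1.
by rewrite -pointwise_actM mulVg pointwise_act1.
Qed.

(* [dfwith x u] is the family x with its component of index i replaced by u. *)
Definition multilinear_rel : set free_rep := [set r |
  exists (i : I) (x : X) (a : k) (u v : rho i),
    r = delta (dfwith x (a *: u + v)) - (a *: delta (dfwith x u) + delta (dfwith x v))].

Lemma pointwise_act_dfwith g x i (u : rho i) :
  pointwise_act g (dfwith x u) = dfwith (pointwise_act g x) (act (rho i) g u).
Proof.
apply: functional_extensionality_dep => j; rewrite /pointwise_act.
by case: dfwithP => [|j' ij]; rewrite ?dfwith_in ?dfwith_out.
Qed.

Fact tensor_stable : @stable _ _ free_rep (span_pred multilinear_rel).
Proof.
move=> g w /asboolP Hw; apply/asboolP => S Sc relS.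
have SZ := GRing.submod_closed_semi Sc.
have actL := @act_linear _ _ free_rep g.
have act0 : act free_rep g 0 = 0.
  by rewrite -[X in act _ _ X](subrr 0) -scaleN1r addrC actL scaleN1r addNr.
pose T : {pred free_rep} := fun v => act free_rep g v \in S.
have TE v : (v \in T) = (act free_rep g v \in S) by [].
suff : w \in T by rewrite TE.
apply: (Hw T) => [|r].
  split=> [|a u v]; first by rewrite TE act0; case: Sc.
  by rewrite !TE actL; apply: Sc.2.
rewrite TE => -[i [x [a [u [v ->]]]]]; apply: relS.
exists i, (pointwise_act g x), a, (act (rho i) g u), (act (rho i) g v).
have actB y z : act free_rep g (y - z) = act free_rep g y - act free_rep g z.
  by rewrite -[- z]scaleN1r addrC actL scaleN1r addrC.
by rewrite actB actL !act_delta !pointwise_act_dfwith act_linear.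
Qed.

Definition tensor_rep : rep k G := quot_rep tensor_stable.

Definition pure_tensor (x : X) : tensor_rep := quotpi _ (delta x).

Lemma act_pure_tensor g x :
  act tensor_rep g (pure_tensor x) = pure_tensor (pointwise_act g x).
Proof.
by apply: etrans (quot_act_pi tensor_stable g (delta x)) _; rewrite act_delta.
Qed.

Lemma pure_tensor_linear (x : X) (i : I) :
  linear (fun u : rho i => pure_tensor (dfwith x u)).
Proof.
move=> a u v; rewrite /pure_tensor -quotpi_linear; apply/quot_eqP.
by apply: span_sub; exists i, x, a, u, v.
Qed.

End Tensor.

Definition tensor2_rep (k : fieldType) (G : groupType) (rho sigma : rep k G) :=
  tensor_rep (fun b : bool => if b then rho else sigma).

Section Series.
Variables (p : nat) (p_pr : prime p) (F : fieldExtType (padic p_pr)) (k : fieldType).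

Definition GL2 : groupType := units 'M[F]_2.
Definition Fx : groupType := units F.
Definition kx : groupType := units k.

Definition GL2_open (U : set GL2) := units_open (@mx_ball _ _ F) U.
Definition Fx_open (U : set Fx) := units_open (@ext_ball _ _ F) U.

Definition smooth_char (theta : {multiplicative Fx -> kx}) :=
  exists K, open_subgroup Fx_open K /\ forall x, K x -> theta x = 1%g.

Fact det_unit (g : GL2) : \det (uval g) \is a GRing.unit.
Proof. by rewrite -unitmxE; apply: uvalP. Qed.
Definition GL2_det (g : GL2) : Fx := Units (det_unit g).
Fact GL2_detM : {morph GL2_det : g h / (g * h)%g}.
Proof. by move=> g h; apply/val_inj/det_mulmx. Qed.
HB.instance Definition _ := isMultiplicative.Build GL2 Fx GL2_det GL2_detM.

Definition borel_mx (x y z : F) : 'M[F]_2 :=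
  \matrix_(i, j) if i == ord0 then (if j == ord0 then x else z)
                 else (if j == ord0 then 0 else y).
Fact borel_unit (x y : Fx) (z : F) : borel_mx (uval x) (uval y) z \is a GRing.unit.
Proof.
rewrite -[_ \is a _]/(_ \in unitmx) unitmxE (expand_det_col _ ord0) big_ord_recl big_ord1.
rewrite /cofactor !det_mx11 !mxE /= mul0r addr0 expr0 mul1r.
by rewrite unitrM !uvalP.
Qed.
(* The matrix with rows (x, z) and (0, y). *)
Definition borel (x y : Fx) (z : F) : GL2 := Units (borel_unit x y z).

Definition trans_act (g : GL2) (f : GL2 -> k^o) : GL2 -> k^o := fun g' => f (g' * g)%g.
Fact trans_act_linear g : linear (trans_act g). Proof. by []. Qed.
Fact trans_act1 f : trans_act 1%g f = f.
Proof. by apply/funext => g; rewrite /trans_act mulg1. Qed.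
Fact trans_actM g h f : trans_act (g * h)%g f = trans_act g (trans_act h f).
Proof. by apply/funext => g'; rewrite /trans_act mulgA. Qed.
Definition trans_rep : rep k GL2 := Rep trans_act_linear trans_act1 trans_actM.

Lemma GL2_open_subgroupI K L : open_subgroup GL2_open K -> open_subgroup GL2_open L ->
  open_subgroup GL2_open (K `&` L).
Proof.
move=> [K1 KM KV Ko] [L1 LM LV Lo]; split=> //.
- by move=> g h [? ?] [? ?]; split; [apply: KM | apply: LM].
- by move=> g [? ?]; split; [apply: KV | apply: LV].
- move=> g [/Ko[m Hm] /Lo[n Hn]]; exists (maxn m n) => h Hh; split.
    by apply: Hm; apply: mx_ballS Hh; apply: leq_maxl.
  by apply: Hn; apply: mx_ballS Hh; apply: leq_maxr.
Qed.

Lemma GL2_open_subgroupJ K g : open_subgroup GL2_open K ->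
  open_subgroup GL2_open [set h | K (g^-1 * h * g)%g].
Proof.
move=> [K1 KM KV Ko]; split=> /=.
- by rewrite mulg1 mulVg.
- move=> a b Ka Kb; have := KM _ _ Ka Kb.
  by rewrite !mulgA -(mulgA _ g) mulgV mulg1.
- by move=> a /KV; rewrite !invMg invgK mulgA.
- move=> a /= /Ko[m Hm].
  have [n Hn] := mx_ballM (uval g^-1%g) (uval g) m.
  exists n => b /Hn; rewrite mulmxBr mulmxBl => Hb.
  exact: (Hm (g^-1 * b * g)%g Hb).
Qed.

Section Induction.
Variables theta1 theta2 : {multiplicative Fx -> kx}.

Definition ind_pred : {pred trans_rep} := fun f : GL2 -> k^o => `[<
  (forall x y z g, f (borel x y z * g)%g = uval (theta1 x) * uval (theta2 y) * f g) /\
  exists K, open_subgroup GL2_open K /\ forall h g, K h -> f (g * h)%g = f g >].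

Fact ind_submod : subsemimod_closed ind_pred.
Proof.
split; first split.
- apply/asboolP; split=> [x y z g|]; first by rewrite mulr0.
  exists setT; split=> //; split=> // x _; by exists 0%N.
- move=> f f' /asboolP[fB [K [Ko fK]]] /asboolP[fB' [K' [Ko' fK']]].
  apply/asboolP; split=> [x y z g|]; first by rewrite !fctE fB fB' mulrDr.
  exists (K `&` K')%classic; split; first exact: GL2_open_subgroupI.
  by move=> h g [Kh Kh']; rewrite !fctE fK // fK'.
- move=> a f /asboolP[fB [K [Ko fK]]].
  apply/asboolP; split=> [x y z g|]; first by rewrite !fctE fB mulrCA.
  by exists K; split=> // h g Kh; rewrite !fctE fK.
Qed.
HB.instance Definition _ :=
  GRing.isSubmodClosed.Build k trans_rep ind_pred ind_submod.

Fact ind_stable : stable ind_pred.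
Proof.
move=> g f /asboolP[fB [K [Ko fK]]]; apply/asboolP; split=> [x y z h|].
  by rewrite /= /trans_act -mulgA fB.
exists [set h | K (g^-1 * h * g)%g]; split; first exact: GL2_open_subgroupJ.
move=> h g' /= Kh; rewrite /trans_act -(fK _ (g' * g)%g Kh); congr f.
by rewrite !mulgA -(mulgA _ g) mulgV mulg1.
Qed.

Definition ind_rep : rep k GL2 := sub_rep ind_stable.

End Induction.

Definition principal_series (pi : rep k GL2) :=
  exists theta1 theta2 : {multiplicative Fx -> kx},
    [/\ smooth_char theta1, smooth_char theta2, exists x, theta1 x <> theta2 x
      & isomorphic pi (ind_rep theta1 theta2)].

Definition one_char (x : Fx) : kx := 1%g.
Fact one_charM : {morph one_char : x y / (x * y)%g}.
Proof. by move=> x y; rewrite mulg1. Qed.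
HB.instance Definition _ := isMultiplicative.Build Fx kx one_char one_charM.

Definition ind_one : rep k GL2 := ind_rep one_char one_char.

Definition const_pred : {pred ind_one} := fun f =>
  `[< exists c : k, forall g : GL2, submod_val f g = c >].
Fact const_submod : subsemimod_closed const_pred.
Proof.
split; first split.
- by apply/asboolP; exists 0.
- move=> f f' /asboolP[c fc] /asboolP[c' fc']; apply/asboolP; exists (c + c').
  by move=> g; rewrite -(fc g) -(fc' g).
- move=> a f /asboolP[c fc]; apply/asboolP; exists (a * c).
  by move=> g; rewrite -(fc g).
Qed.
HB.instance Definition _ :=
  GRing.isSubmodClosed.Build k ind_one const_pred const_submod.
Fact const_stable : stable const_pred.
Proof.
by move=> g f /asboolP[c fc]; apply/asboolP; exists c => g'; apply: (fc (g' * g)%g).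
Qed.

Definition Sp : rep k GL2 := quot_rep const_stable.

Definition special_series (pi : rep k GL2) :=
  exists theta : {multiplicative Fx -> kx},
    smooth_char theta /\
    isomorphic pi (tensor2_rep Sp (char_rep (theta \o GL2_det))).

End Series.

(* Main.v *)
Require Import Defs.
From HB Require Import structures.
From mathcomp Require Import all_boot all_order all_algebra all_fingroup all_field.
From mathcomp Require Import boolp classical_sets functions cardinality filter.
From mathcomp Require Import zify ring.

(** The reason is that Haar measure does not exist in characteristic [p].  Let
    [Phi] be a G-invariant form on the tensor product.  Consider its dependence
    on one factor, the vectors in the other factors being fixed; each of these
    vectors is invariant under an open subgroup.

    Both kinds of series are quotients of an induced representation [Ind], by a
    map [q] that is equivariant under the matrices of determinant 1: for a
    principal series [q] is an isomorphism, and for [Sp (x) theta o det] one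
    takes [Ind] of the trivial character and maps [f] to [class(f) (x) 1]
    ([principal_quotient], [special_quotient]).  Sections of [Ind] live on the
    projective line, with coordinate the slope [t = d / c] of the bottom row
    [(c, d)] of a matrix; the upper unipotent matrix with entry [x] translates
    the slope by [x].

    Let [f] be a section vanishing at infinity and let [v_i] be the vectors in the
    other factors.  The support of [f] is a bounded set of slopes, as [f] vanishes
    near infinity.  There is a set [D] that is a union of cosets of a small
    lattice, and a vector [c], as small as one likes, such that the translates
    [D - i c] with [0 <= i < p] partition [F].  Cutting [f] by [D] gives a section
    [f'] with [f = sum_i u(i c) f'] ([sec_tiling]).  If [c] is so small that the
    [u(i c)] fix the [v_i], invariance gives
    [Phi(q f, v) = p * Phi(q f', v) = 0] ([form_vanish_at_infinity]).
    Any section is the sum of one that vanishes at infinity and one that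
    vanishes at another point ([sec_split]), and a matrix of determinant 1
    moves that point to infinity, so [Phi] is zero ([form_vanish]).

    Two facts on the topology of [F] are used.  Moebius transformations close
    to the identity move the points of a bounded set by little
    ([moebius_near]), so that restricting a section to a bounded union of
    cosets of a lattice keeps it smooth.  Inverses of elements outside a
    neighbourhood of 0 are bounded ([ext_ballV]): this is where local
    compactness enters, as the topology of [F] is given by a lattice and not by a
    multiplicative norm. *)

Set Implicit Arguments.
Unset Strict Implicit.
Unset Printing Implicit Defensive.

Import GRing.Theory.
Local Open Scope ring_scope.

(** * The p-adic numbers *)

Section PadicBalls.
Variables (p : nat) (p_pr : prime p).
Local Notation Zp := (padic_int p_pr).
Local Notation Qp := (padic p_pr).
Local Notation ball := (padic_ball p_pr).

Let p_gt0 m : (0 < p ^ m)%N. Proof. by rewrite expn_gt0 prime_gt0. Qed.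

Lemma padic_dvd_pX (z : Zp) m : z m = 0%N -> exists y, z = p%:R ^+ m * y.
Proof.
move=> zm; pose u n := (z (n + m) %/ p ^ m)%N.
have zu n : z (n + m)%N = (u n * p ^ m)%N.
  by rewrite /u divnK // /dvdn -pcomp_mod ?zm // leq_addl.
have uS n : (u n = u n.+1 %[mod p ^ n])%N.
  apply/eqP; rewrite -(@eqn_pmul2r (p ^ m)) // !muln_modl // -!zu -expnD.
  by rewrite pcomp_small addSn -pcompS.
exists (padic_of p_pr uS); rewrite -natrX padic_natE; apply/padic_eqP => n /=.
rewrite modnMml modnMmr mulnC -zu; apply: pcomp_mod; exact: leq_addr.
Qed.

Lemma pcomp_pXM m (y : Zp) : (p%:R ^+ m * y : Zp) m = 0%N.
Proof. by rewrite -natrX padic_natE /= modnn mul0n mod0n. Qed.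

Lemma pcompB_eq0 m (x y : Zp) : x m = y m :> nat -> (x - y : Zp) m = 0%N.
Proof. by move=> /= ->; rewrite modnDmr addnC -mulSnr prednK ?modnMr. Qed.

Local Notation tof := (@FracField.tofrac (GRing.IntegralDomain.clone _ Zp)).

Lemma padic_mulrn_pX (x : Qp) k : x *+ p ^ k = (tof (p%:R ^+ k) : Qp) * x.
Proof. by rewrite -[LHS]mulr_natl -[in RHS]natrX (rmorph_nat tof). Qed.

Lemma tofrac_pX_neq0 k : tof ((p%:R : Zp) ^+ k) != 0.
Proof. by rewrite tofrac_eq0 padic_expp_neq0. Qed.

Lemma padic_ball_pX m k (x : Qp) : ball (m + k) (x *+ p ^ k) <-> ball m x.
Proof.
rewrite padic_mulrn_pX; split=> -[z]; last first.
  by move=> ->; exists z; rewrite -tofracM mulrA -exprD addnC.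
rewrite addnC exprD -mulrA (tofracM (p%:R ^+ k)).
by move/(mulfI (tofrac_pX_neq0 k)) => ->; exists z.
Qed.

Lemma padic_ballN m (x : Qp) : ball m x -> ball m (- x).
Proof. by move=> [z ->]; exists (- z); rewrite mulrN tofracN. Qed.

Lemma padic_ballMr m (x y : Qp) : ball 0 x -> ball m y -> ball m (x * y).
Proof.
by move=> [a ->] [b ->]; exists (a * b); rewrite expr0 mul1r -tofracM mulrCA.
Qed.

(** Balls are indexed by natural numbers only; that [x] lies in a ball of
    negative index is expressed by putting a multiple [x *+ p ^ k] in a ball. *)
Lemma padic_ball_absorb (x : Qp) m : exists k, ball m (x *+ p ^ k).
Proof.
have [k Hk] := padic_ballM x m; exists k.
by rewrite padic_mulrn_pX mulrC; apply: Hk; exists 1; rewrite mulr1.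
Qed.

Lemma padic_ball_int m (z : Zp) : ball m (tof z) <-> z m = 0%N.
Proof.
split=> [[y /eqP]|/padic_dvd_pX[y ->]]; last by exists y.
by rewrite tofrac_eq => /eqP->; apply: pcomp_pXM.
Qed.

Lemma padic_ball_sep (x : Qp) : (forall m, ball m x) -> x = 0.
Proof.
move=> xm; have [z xz] := xm 0%N; rewrite expr0 mul1r in xz.
rewrite xz (_ : z = 0) ?tofrac0 //; apply/padic_eqP => m /=.
by rewrite mod0n; apply/padic_ball_int; rewrite -xz.
Qed.

Lemma ultra_const (T : Type) (U : set_system T) (h : T -> nat) q :
  UltraFilter U -> (forall t, h t < q)%N -> exists a, U [set t | h t = a]%classic.
Proof.
move=> UU hq; apply/not_existsP => nU.
have nU' a : U (~` [set t | h t = a])%classic.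
  by have [/nU|] := in_ultra_setVsetC [set t | h t = a]%classic UU.
have [t tU] : exists t, forall a : 'I_q, (~` [set t | h t = a])%classic t.
  by apply: (@filter_ex _ U); apply: filter_forall => a; apply: nU'.
by apply: (tU (Ordinal (hq t))).
Qed.

(** Compactness of Z_p: along an ultrafilter the residue of [x] modulo each
    [p ^ m] is constant, and these constants form a p-adic integer. *)
Lemma padic_int_ultralim (T : Type) (U : set_system T) (x : T -> Zp) :
  UltraFilter U -> exists l : Zp, forall m, U [set t | x t m = l m :> nat]%classic.
Proof.
move=> UU.
have /choice[u Uu] m : exists a, U [set t | x t m = a]%classic.
  by apply: (@ultra_const _ _ _ (p ^ m)) => t; rewrite -pcomp_small ltn_mod.
have uS n : (u n = u n.+1 %[mod p ^ n])%N.
  have [t [<- <-]] := filter_ex (filterI (Uu n) (Uu n.+1)).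
  by rewrite [x t n]pcompS modn_mod.
exists (padic_of p_pr uS) => m; apply: filterS (Uu m) => t /= <-.
by rewrite pcomp_small.
Qed.

(** Let [D] consist of the [x] whose difference with a chosen representative of
    the coset [x + p ^ m Z_p] has digit 0 at index [m]; adding [p ^ m] to [x]
    increments this digit modulo [p], and leaves the representative unchanged. *)
Lemma padic_tiling m : exists D : Qp -> Prop,
  (forall x y, D x -> ball m.+1 (y - x) -> D y) /\
  forall x, exists j : 'I_p, forall i : 'I_p, D (x + 1 *+ p ^ m *+ i) <-> i = j.
Proof.
pose rep x := xget 0 [set y | ball m (y - x)]%classic.
have rep_ball x : ball m (x - rep x).
  rewrite /rep; case: xgetP => [y _ /padic_ballN|/(_ x)]; first by rewrite opprB.
  by case; rewrite /= subrr; apply: padic_ball0.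
have repE x y : ball m (y - x) -> rep y = rep x.
  move=> xy; congr xget; apply/seteqP; split=> z /= zx.
    by rewrite -(subrKA y); apply: padic_ballD zx xy.
  by rewrite -(subrKA x); apply: padic_ballD zx _; rewrite -opprB;
    apply: padic_ballN.
exists (fun x => ball m.+1 (x - rep x)); split=> [x y Dx xy|x].
  rewrite (repE x); last by apply: padic_ballS xy.
  by rewrite -(subrKA x); apply: padic_ballD xy Dx.
have [z zE] := rep_ball x.
have DE (i : 'I_p) :
    ball m.+1 (x + 1 *+ p ^ m *+ i - rep (x + 1 *+ p ^ m *+ i)) <->
    ((z 1%N + i) %% p = 0)%N.
  have cE : (1 : Qp) *+ p ^ m *+ i = tof i%:R *+ p ^ m.
    by rewrite (rmorph_nat tof) -!mulrnA mulnC.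
  rewrite (repE x); last first.
    by rewrite addrC addKr cE padic_mulrn_pX -tofracM; exists i%:R.
  rewrite addrAC zE tofracM -padic_mulrn_pX cE -mulrnDl -tofracD -add1n.
  by rewrite padic_ball_pX padic_ball_int padic_natE /= expn1 modnDmr.
have p0 := prime_gt0 p_pr.
exists (Ordinal (ltn_pmod (p - z 1%N) p0)) => i; rewrite DE.
have z1 : (z 1%N < p)%N by rewrite -pcomp_small expn1 ltn_mod.
split=> [zi|->] /=; last by rewrite modnDmr subnKC ?modnn // ltnW.
apply/val_inj => /=; rewrite -[val i](modn_small (ltn_ord i)).
by apply/eqP; rewrite -(eqn_modDl (z 1%N)) zi subnKC ?modnn // ltnW.
Qed.

End PadicBalls.

(** * Lattice topology of a finite extension *)

Section ExtensionBalls.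
Variables (p : nat) (p_pr : prime p) (F : fieldExtType (padic p_pr)).
Local Notation e := (vbasis {:F}).
Local Notation ball := (@ext_ball p p_pr F).

Lemma ext_ball_pX m k x : ball (m + k) (x *+ p ^ k) <-> ball m x.
Proof.
split=> xm i; last by rewrite raddfMn; apply/padic_ball_pX/xm.
by have := xm i; rewrite raddfMn => /padic_ball_pX.
Qed.

Lemma ext_ball0_pX k x : ball 0 x -> ball k (x *+ p ^ k).
Proof. exact: (ext_ball_pX 0 k x).2. Qed.

Lemma ext_ballN m x : ball m x -> ball m (- x).
Proof. by move=> xm i; rewrite linearN; apply: padic_ballN (xm i). Qed.

Lemma ext_ballB m x y : ball m x -> ball m y -> ball m (x - y).
Proof. by move=> xm /ext_ballN; apply: ext_ballD. Qed.

Lemma ext_ballMn m x n : ball m x -> ball m (x *+ n).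
Proof.
move=> xm; elim: n => [|n IHn]; first exact: ext_ball0.
by rewrite mulrS; apply: ext_ballD.
Qed.

Lemma ext_ball_absorb m x : exists k, ball m (x *+ p ^ k).
Proof.
have [i|i k k' le_kk'|k Hk] := @fin_bound _ (fun i k =>
    padic_ball p_pr m (coord e i x *+ p ^ k)).
- exact: padic_ball_absorb.
- move=> /(padic_ball_pX _ (k' - k)); rewrite -mulrnA -expnD subnKC //.
  exact/padic_ballS/leq_addr.
by exists k => i; rewrite raddfMn; apply: Hk.
Qed.

Lemma ext_ball_div m k x : ball (m + k) x -> exists2 y, x = y *+ p ^ k & ball m y.
Proof.
have pk0 : ((p ^ k)%:R : F) != 0.
  rewrite -(rmorph_nat (in_alg F)) fmorph_eq0; apply/eqP => pk0.
  have := tofrac_pX_neq0 p_pr k; rewrite -[X in X != _]mulr1 -padic_mulrn_pX.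
  by rewrite pk0 eqxx.
move=> xm; exists (x / (p ^ k)%:R); last apply/(ext_ball_pX m k).
  by rewrite -[RHS]mulr_natr divfK.
by rewrite -[_ *+ _]mulr_natr divfK.
Qed.

Lemma ext_ball_sep x : (forall m, ball m x) -> x = 0.
Proof.
move=> xm; rewrite (coord_vbasis (memvf x)) big1 // => i _.
by rewrite (padic_ball_sep (fun m => xm m i)) scale0r.
Qed.

(** Multiplication is bounded for the lattice norm, because the structure
    constants of the basis have a common denominator [p ^ C]. *)
Lemma ext_ballMM : exists C, forall k n x y,
  ball (C + k) x -> ball n y -> ball (n + k) (x * y).
Proof.
have [i|i c c' le_cc' H y yn|C HC] := @fin_bound _
    (fun (i : 'I_(\dim {:F})) c => forall y, ball c y -> ball 0 (e`_i * y)).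
- exact: ext_ballM.
- by apply: H; apply: ext_ballS yn.
exists C => k n x y /ext_ball_div[{}x -> xC].
rewrite -[n in ball n y]add0n => /ext_ball_div[{}y -> y0].
rewrite mulrnAl mulrnAr; apply/ext_ball_pX; rewrite -[n]add0n; apply/ext_ball_pX.
rewrite (coord_vbasis (memvf y)) mulr_sumr; apply: ext_ball_sum => i j.
rewrite -scalerAr linearZ mulrC -[X in padic_ball _ _ X]/(_ * _) mulrC.
by apply: padic_ballMr; [apply: y0 | rewrite mulrC; apply: HC].
Qed.

Lemma ext_ball_ultralim (T : Type) (U : set_system T) (x : T -> F) :
  UltraFilter U -> (forall t, ball 0 (x t)) ->
  exists l, forall m, U [set t | ball m (l - x t)]%classic.
Proof.
move=> UU x0.
have /choice[z zE] (ti : T * 'I_(\dim {:F})) : exists z : padic_int p_pr,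
    coord e ti.2 (x ti.1) = FracField.tofrac z.
  by have [z ->] := x0 ti.1 ti.2; exists z; rewrite expr0 mul1r.
have /choice[l lE] i := padic_int_ultralim (fun t => z (t, i)) UU.
pose c i : padic p_pr := FracField.tofrac (l i).
exists (\sum_i c i *: e`_i) => m.
have {lE} : U [set t | forall i, z (t, i) m = l i m :> nat]%classic.
  by apply: filter_forall => i; apply: lE.
apply: filterS => t /= ltm i.
rewrite linearB /= coord_sum_free ?(basis_free (vbasisP _)) // (zE (t, i)).
by rewrite -tofracB; apply/padic_ball_int/pcompB_eq0/esym/ltm.
Qed.

(** Dividing by an element close to 1 preserves every ball, with the same
    closeness for all balls. If [p ^ k.+1 * s] lies in the ball, the identity
    [s = s (1 + x) - x s] shows that [p ^ k * s] does too. *)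
Lemma ext_ball_unit : exists C, forall n x s,
  ball C x -> ball n (s * (1 + x)) -> ball n s.
Proof.
have [C HC] := ext_ballMM; exists (C + 1)%N => n x s xC sxn.
have [k] := ext_ball_absorb n s.
elim: k => [|k IHk] sk; first by rewrite expn0 mulr1n in sk.
apply: IHk; rewrite (_ : s *+ p ^ k = (s * (1 + x)) *+ p ^ k - x * (s *+ p ^ k)).
  apply: ext_ballB; first exact: ext_ballMn.
  by apply/(ext_ball_pX n 1); rewrite expn1 -mulrnAr -mulrnA -expnSr; apply: HC.
by rewrite mulrDr mulr1 mulrnDl -mulrnAr mulrC mulrnAr mulrnAl mulrC addrK.
Qed.

Lemma ext_ballM_scaled : exists C, forall R n t y,
  ball 0 (t *+ p ^ R) -> ball (n + R + C) y -> ball n (t * y).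
Proof.
have [C HC] := ext_ballMM; exists C => R n t y tR yn.
have tC : ball C (t *+ p ^ R *+ p ^ C) by apply/(ext_ball_pX 0 C).
apply/(ext_ball_pX n (R + C)); rewrite addnA expnD mulrnA -!mulrnAl.
by have := HC 0%N _ _ _ _ yn; rewrite !addn0; apply.
Qed.

Lemma ext_ballMM0 : exists C, forall m x y,
  ball 0 x -> ball (m + C) y -> ball m (x * y).
Proof.
have [C HC] := ext_ballM_scaled; exists C => m x y x0 ym.
by apply: (HC 0%N); rewrite ?expn0 ?addn0.
Qed.

Definition primitive x := ball 0 x /\ ~ ball 1 x.

Lemma primitive_scale x : x != 0 ->
  exists a b y, primitive y /\ x *+ p ^ a = y *+ p ^ b.
Proof.
move=> x0; have [a xa] := ext_ball_absorb 0 x.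
have nx : exists m, ~~ `[< ball m (x *+ p ^ a) >].
  apply/not_existsP => xm; case/eqP: x0; apply: ext_ball_sep => m.
  by apply/(ext_ball_pX m a); have /negP := xm (m + a)%N; rewrite negbK => /asboolP.
case: (ex_minnP nx) => -[|b] xb b_min; first by case/asboolP: xb.
have : ball (0 + b) (x *+ p ^ a).
  by apply/asboolP/negPn/negP => /b_min; rewrite ltnn.
move=> /ext_ball_div[y xE y0]; exists a, b, y; split=> //; split=> // y1.
by case/asboolP: xb; rewrite xE -add1n; apply/ext_ball_pX.
Qed.

(** A sequence of pairs of primitive elements whose products tend to 0 would
    have, by compactness, a limit: a pair of nonzero elements with product 0. *)
Lemma primitiveM_bound : exists R, forall x y,
  primitive x -> primitive y -> ~ ball R (x * y).
Proof.
apply/not_existsP => noR.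
have /choice[xy Hxy] R : exists xy : F * F,
    [/\ primitive xy.1, primitive xy.2 & ball R (xy.1 * xy.2)].
  apply: contrapT => nxy; apply: (noR R) => x y px py Rxy.
  by apply: nxy; exists (x, y).
have px n : primitive (xy n).1 by case: (Hxy n).
have py n : primitive (xy n).2 by case: (Hxy n).
have pxy n : ball n ((xy n).1 * (xy n).2) by case: (Hxy n).
have [U [UU Uoo]] := ultraFilterLemma eventually_filter.
have [x xE] := ext_ball_ultralim UU (fun n => (px n).1).
have [y yE] := ext_ball_ultralim UU (fun n => (py n).1).
have nz z (w : nat -> F) : (forall n, primitive (w n)) ->
    (forall m, U [set n | ball m (z - w n)]%classic) -> ball 0 z /\ z != 0.
  move=> pw zw; have [n [zwn0 zwn1]] := filter_ex (filterI (zw 0%N) (zw 1%N)).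
  have [wn0 wn1] := pw n; split.
    by rewrite -(subrK (w n) z); apply: ext_ballD.
  apply: contra_notN wn1 => /eqP z0.
  by have := ext_ballN zwn1; rewrite z0 sub0r opprK.
have [x0 xn0] := nz x _ px xE.
have [y0 yn0] := nz y _ py yE.
suff : x * y = 0 by move/eqP; rewrite mulf_eq0 (negPf xn0) (negPf yn0).
apply: ext_ball_sep => m; have [C HC] := ext_ballMM0.
have Um : U [set n | m <= n]%N%classic by apply: Uoo; exists m.
have [n [[/= xn yn] mn]] :=
  filter_ex (filterI (filterI (xE (m + C)%N) (yE (m + C)%N)) Um).
have [[px0 _] [py0 _]] := (px n, py n).
rewrite (_ : x * y =
    x * (y - (xy n).2) + (xy n).2 * (x - (xy n).1) + (xy n).1 * (xy n).2).
  by apply: ext_ballD; [apply: ext_ballD; apply: HC | apply: ext_ballS (pxy n)].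
ring.
Qed.

(** As products of primitive elements are bounded below, the lattice norm of
    [s^-1] is at most a constant multiple of the inverse of that of [s].  On the
    projective line this says that the slopes outside a suitable bounded set all
    lie in a given neighbourhood of infinity. *)
Lemma ext_ballV m : exists R, forall s, ~ ball m s -> ball 0 (s^-1 *+ p ^ R).
Proof.
have [R HR] := primitiveM_bound; have [E HE] := ext_ball_absorb 0 1.
exists (m + R + E)%N => s ms.
have s0 : s != 0 by apply: contra_notN ms => /eqP->; apply: ext_ball0.
have [a [b [x [px sx]]]] := primitive_scale s0.
have [c [d [y [py sy]]]] : exists c d y, primitive y /\ s^-1 *+ p ^ c = y *+ p ^ d.
  by apply: primitive_scale; rewrite invr_eq0.
have cancel (u v : F) k : u *+ p ^ k = v *+ p ^ k -> u = v.
  move=> uv; apply/eqP; rewrite -subr_eq0; apply/eqP/ext_ball_sep => i.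
  by apply/(ext_ball_pX i k); rewrite mulrnBl uv subrr; apply: ext_ball0.
have ba : (b < a + m)%N.
  rewrite ltnNge; apply/negP => le_amb; apply: ms.
  apply/(ext_ball_pX m a); rewrite sx (_ : b = b - (a + m) + (m + a))%N; last lia.
  by rewrite expnD mulrnA; apply/ext_ball0_pX/ext_ballMn; case: px.
have xyE : 1 *+ p ^ (a + c) = (x * y) *+ p ^ (b + d).
  rewrite !expnD !mulrnA -mulrnAl -mulrnAr -sx -sy mulrnAl mulrnAr.
  by rewrite divff // -mulrnA mulnC mulrnA.
have ac : (a + c < b + d + R + E)%N.
  rewrite ltnNge; apply/negP => le_ac; apply: (HR x y px py).
  rewrite (cancel (x * y) ((1 *+ p ^ E) *+ p ^ (a + c - (b + d) - E)) (b + d)%N).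
    apply: (@ext_ballS _ _ _ _ (a + c - (b + d) - E)); first lia.
    exact: ext_ball0_pX.
  by rewrite -xyE -!mulrnA -!expnD; congr (_ *+ _ ^ _)%R; lia.
apply/(ext_ball_pX 0 c); rewrite -mulrnA mulnC mulrnA sy -mulrnA -expnD.
rewrite (_ : d + (m + R + E) = d + (m + R + E) - c + c)%N ?expnD ?mulrnA; last lia.
by apply/ext_ball0_pX/ext_ballMn; case: py.
Qed.

Lemma ext_tiling m : exists (c : F) (D : F -> Prop),
  [/\ ball m c, forall x y, D x -> ball m.+1 (y - x) -> D y &
  forall x, exists j : 'I_p, forall i : 'I_p, D (x + c *+ i) <-> i = j].
Proof.
have [D [D_ball D_tile]] := padic_tiling p_pr m.
have i0 : 'I_(\dim {:F}) := Ordinal (adim_gt0 {:F}%AS).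
exists (e`_i0 *+ p ^ m), (fun x => D (coord e i0 x)); split.
- apply: ext_ball0_pX => i; rewrite coord_free ?(basis_free (vbasisP _)) //.
  by exists (i0 == i)%:R; rewrite expr0 mul1r rmorph_nat.
- by move=> x y Dx xy; apply: D_ball Dx _; rewrite -linearB; apply: xy.
move=> x; have [j Hj] := D_tile (coord e i0 x); exists j => i.
rewrite -Hj linearD !raddfMn /= coord_free ?(basis_free (vbasisP _)) //.
by rewrite eqxx.
Qed.

(** The displacement of [t] is [(b + t (d - 1) - t (a - 1) - t (t c)) / (a + t c)]:
    on a bounded set of [t] its numerator is small and its denominator is close
    to 1. *)
Lemma moebius_near R M : exists m, forall a b c d t,
    ball m (a - 1) -> ball m b -> ball m c -> ball m (d - 1) ->
    ball 0 (t *+ p ^ R) ->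
  a + t * c != 0 /\ ball M ((b + t * d) / (a + t * c) - t).
Proof.
have [C1 unit_near] := ext_ball_unit; have [C ballM] := ext_ballM_scaled.
exists (M + C1 + R + C + R + C)%N => a b c d t am bm cm dm tR.
have bS n x : (n <= M + C1 + R + C + R + C)%N ->
  ball (M + C1 + R + C + R + C)%N x -> ball n x by apply: ext_ballS.
have tm n x : (n <= M + C1)%N ->
    ball (M + C1 + R + C + R + C)%N x -> ball n (t * x).
  by move=> le_n xm; apply: (ballM R) => //; apply: bS xm; lia.
have ttc : ball M (t * (t * c)).
  do 2![apply: (ballM R) => //]; apply: bS cm; lia.
have xC : ball C1 ((a - 1) + t * c).
  by apply: ext_ballD; [apply: bS am; lia | apply: tm cm; lia].
have acE : a + t * c = 1 + ((a - 1) + t * c) by ring.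
have ac0 : a + t * c != 0.
  apply/eqP => ac0; case/eqP: (oner_neq0 F); apply: ext_ball_sep => n.
  by apply: unit_near xC _; rewrite -acE ac0 mulr0; apply: ext_ball0.
split=> //; apply: unit_near xC _; rewrite -acE mulrBl divfK //.
rewrite (_ : _ - _ = b + t * (d - 1) - t * (a - 1) - t * (t * c)); last ring.
apply: ext_ballB => //; apply: ext_ballB; last by apply: tm am; lia.
by apply: ext_ballD; [apply: bS bm | apply: tm dm]; lia.
Qed.

End ExtensionBalls.

(** * Matrices of size 2 and the projective line *)

Section GL2.
Variables (p : nat) (p_pr : prime p) (F : fieldExtType (padic p_pr)).
Local Notation G := (GL2 F).
Local Notation ball := (@ext_ball p p_pr F).

Definition near1 m (h : G) := mx_ball m (uval h - 1).

Lemma mulmx2E (A B : 'M[F]_2) i j : (A *m B) i j = A i 0 * B 0 j + A i 1 * B 1 j.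
Proof.
rewrite mxE !big_ord_recl big_ord0 addr0 !(ord1, lift0).
by congr (_ + A i _ * B _ j); apply: val_inj.
Qed.

Lemma det2E (A : 'M[F]_2) : \det A = A 0 0 * A 1 1 - A 0 1 * A 1 0.
Proof.
rewrite (expand_det_row _ 0) !big_ord_recl big_ord0 addr0 /cofactor !det_mx11 !mxE.
rewrite !lift0 expr0 expr1 mul1r mulN1r mulrN.
by congr (A _ _ * A _ _ - A _ _ * A _ _); apply: val_inj.
Qed.

Lemma GL2_mulE (g h : G) i j :
  uval (g * h)%g i j = uval g i 0 * uval h 0 j + uval g i 1 * uval h 1 j.
Proof. exact: mulmx2E. Qed.

Lemma borelP (b : G) : uval b 1 0 = 0 -> exists x y z, b = borel x y z.
Proof.
move=> b10; have := det_unit b; rewrite det2E b10 mulr0 subr0 unitrM.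
move=> /andP[b00 b11].
exists (Units b00), (Units b11), (uval b 0 1); apply/val_inj/matrixP => i j /=.
rewrite mxE; case: (unliftP 0 i) => [i'|] -> /=; rewrite ?ord1; last first.
  by case: (unliftP 0 j) => [j'|] -> //=; rewrite ?ord1;
    congr (uval b _ _); apply: val_inj.
by case: (unliftP 0 j) => [j'|] -> //=; rewrite ?ord1 -?b10;
  congr (uval b _ _); apply: val_inj.
Qed.

(** The orbit of [g] under the Borel subgroup is the point of the projective
    line whose homogeneous coordinates are the bottom row of [g]. *)
Lemma borel_orbit (g g' : G) y :
  uval g' 1 0 = y * uval g 1 0 -> uval g' 1 1 = y * uval g 1 1 ->
  exists x y z, g' = (borel x y z * g)%g.
Proof.
move=> g'0 g'1; have [|x [y' [z gE]]] := @borelP (g' * g^-1)%g; last first.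
  by exists x, y', z; rewrite -gE mulgKV.
rewrite GL2_mulE g'0 g'1 -!mulrA -mulrDr -GL2_mulE mulgV mxE.
by rewrite mulr0.
Qed.

Definition unip x : G := borel 1 1 x.

Fact lower_unit x : (uval (unip x))^T \is a GRing.unit.
Proof. by rewrite -[_ \is a _]/(_ \in unitmx) unitmx_tr; exact: uvalP. Qed.
Definition lower x : G := Units (lower_unit x).

Lemma det_unip x : GL2_det (unip x) = 1%g.
Proof. by apply: val_inj; rewrite /= det2E !mxE /= mulr0 subr0 mulr1. Qed.

Lemma det_lower x : GL2_det (lower x) = 1%g.
Proof. by apply: val_inj; rewrite -[RHS](congr1 val (det_unip x)) /= det_tr. Qed.

Lemma near1_unip m x : ball m x -> near1 m (unip x).
Proof.
move=> xm i j; rewrite !mxE.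
by case: (unliftP 0 i) => [i'|] ->; case: (unliftP 0 j) => [j'|] -> //=;
   rewrite ?ord1 ?subrr ?subr0 //; apply: ext_ball0.
Qed.

Lemma near1_lower m x : ball m x -> near1 m (lower x).
Proof.
move=> xm i j; suff -> : (uval (lower x) - 1) i j = (uval (unip x) - 1) j i.
  exact: near1_unip.
by rewrite !mxE (eq_sym i j).
Qed.

Lemma lower10 x : uval (lower x) 1 0 = x. Proof. by rewrite !mxE. Qed.
Lemma lower11 x : uval (lower x) 1 1 = 1. Proof. by rewrite !mxE. Qed.
Lemma GL2_1_10 : uval (1%g : G) 1 0 = 0. Proof. by rewrite mxE. Qed.
Lemma GL2_1_11 : uval (1%g : G) 1 1 = 1. Proof. by rewrite mxE. Qed.

Lemma open_subgroup_near1 (K : set G) : open_subgroup (@GL2_open _ _ F) K ->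
  exists m, forall h, near1 m h -> K h.
Proof. by move=> [K1 _ _ Ko]; have [m Hm] := Ko _ K1; exists m => h; apply: Hm. Qed.

(** Smoothness can be tested near 1: the right stabiliser of a function is a
    subgroup, and a subgroup that contains a neighbourhood of 1 is open. *)
Lemma near1_open_subgroup (T : Type) (phi : G -> T) m :
  (forall h g, near1 m h -> phi (g * h)%g = phi g) ->
  exists K, open_subgroup (@GL2_open _ _ F) K /\
    forall h g, K h -> phi (g * h)%g = phi g.
Proof.
move=> phi_m; exists [set h | forall g, phi (g * h)%g = phi g]%classic; split=> //.
split=> /= [g|g h gK hK g'|g gK g'|h hK]; first by rewrite mulg1.
- by rewrite mulgA hK gK.
- by rewrite -[in RHS](mulgKV g g') gK.
have [n Hn] := mx_ballM (uval h^-1%g) 1 m; exists n => h' hh' g.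
rewrite -(mulKVg h h') mulgA -(hK g); apply: phi_m; have := Hn _ hh'.
rewrite mulmx1 mulmxBr; rewrite -[X in _ - X]/(uval (h^-1 * h)%g) mulVg.
exact.
Qed.

(** The slope [d / c] is the coordinate on the projective line minus the point at
    infinity, which is the orbit of 1. *)
Definition slope_in (S : F -> Prop) (g : G) :=
  uval g 1 0 != 0 /\ S (uval g 1 1 / uval g 1 0).

Lemma slope_in_borel S x y z g : slope_in S (borel x y z * g)%g <-> slope_in S g.
Proof.
have y0 : uval y != 0 by rewrite -unitfE uvalP.
rewrite /slope_in !GL2_mulE !mxE /= !mul0r !add0r mulf_eq0 (negPf y0) /=.
by rewrite -mulf_div divff // mul1r.
Qed.

Lemma slope_unip (g : G) x : uval g 1 0 != 0 ->
  uval (g * unip x)%g 1 1 / uval (g * unip x)%g 1 0 = uval g 1 1 / uval g 1 0 + x.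
Proof.
move=> g10; rewrite !GL2_mulE !mxE /= !mulr1 mulr0 addr0 addrC mulrDl.
by congr (_ + _); rewrite mulrAC divff // mul1r.
Qed.

(** Hence restricting a section to slopes in [S] keeps it smooth.  A matrix close
    to 1 acts on slopes by a Moebius transformation, which moves each point of
    the bounded set [S] by an element of the given ball. *)
Lemma slope_in_near1 (S : F -> Prop) R M :
    (forall t, S t -> ball 0 (t *+ p ^ R)) ->
    (forall t t', S t -> ball M (t' - t) -> S t') ->
  exists m, forall h g, near1 m h -> (slope_in S (g * h)%g <-> slope_in S g).
Proof.
move=> S_bd S_ball; have [m Hm] := moebius_near F R M; exists m => h g hm.
have moebius (a b c d u v : F) :
    ball m (a - 1) -> ball m b -> ball m c -> ball m (d - 1) -> u != 0 ->
    S (v / u) -> u * a + v * c != 0 /\ S ((u * b + v * d) / (u * a + v * c)).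
  move=> am bm cm dm u0 St.
  have [ac0 tt'] := Hm a b c d (v / u) am bm cm dm (S_bd _ St).
  have uE x y : u * x + v * y = u * (x + v / u * y).
    by rewrite mulrDr mulrA [u * (v / u)]mulrC divfK.
  rewrite !uE mulf_neq0 // -mulf_div divff // mul1r; split=> //.
  exact: S_ball St tt'.
have [h00 h01 h10 h11] : [/\ ball m (uval h 0 0 - 1), ball m (uval h 0 1),
    ball m (uval h 1 0) & ball m (uval h 1 1 - 1)].
  split; [have := hm 0 0 | have := hm 0 1 | have := hm 1 0 | have := hm 1 1];
  by rewrite !mxE ?subr0.
split=> [[u0 St]|[u0 St]]; last by rewrite /slope_in !GL2_mulE; apply: moebius.
(* the inverse of a matrix close to 1 acts on slopes as its adjugate, which is
   close to 1 as well *)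
have [] := moebius _ (- uval h 0 1) (- uval h 1 0) _ _ _ h11 _ _ h00 u0 St.
- exact: ext_ballN.
- exact: ext_ballN.
have det0 : \det (uval h) != 0 by rewrite -unitfE det_unit.
rewrite !GL2_mulE.
have -> : (uval g 1 0 * uval h 0 0 + uval g 1 1 * uval h 1 0) * uval h 1 1 +
    (uval g 1 0 * uval h 0 1 + uval g 1 1 * uval h 1 1) * - uval h 1 0 =
    \det (uval h) * uval g 1 0 by rewrite det2E; ring.
have -> : (uval g 1 0 * uval h 0 0 + uval g 1 1 * uval h 1 0) * - uval h 0 1 +
    (uval g 1 0 * uval h 0 1 + uval g 1 1 * uval h 1 1) * uval h 0 0 =
    \det (uval h) * uval g 1 1 by rewrite det2E; ring.
rewrite mulf_eq0 (negPf det0) -mulf_div divff // mul1r.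
by split.
Qed.

End GL2.

(** * Sections of induced representations *)

Local Notation act := Defs.act.

Section InducedSections.
Variables (p : nat) (p_pr : prime p) (F : fieldExtType (padic p_pr)).
Variables (k : fieldType) (theta1 theta2 : {multiplicative Fx F -> kx k}).
Local Notation G := (GL2 F).
Local Notation ball := (@ext_ball p p_pr F).
Local Notation Ind := (ind_rep theta1 theta2).

Definition sec (f : Ind) : G -> k := submod_val f.

Lemma sec_inj (f f' : Ind) : sec f =1 sec f' -> f = f'.
Proof. by move=> ff'; apply/val_inj/funext. Qed.

Lemma sec_act g f g' : sec (act Ind g f) g' = sec f (g' * g)%g.
Proof. by []. Qed.

Lemma secB f f' g : sec (f - f') g = sec f g - sec f' g.
Proof. by []. Qed.

Lemma sec_sum (I : finType) (f : I -> Ind) g :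
  sec (\sum_i f i) g = \sum_i sec (f i) g.
Proof. exact: (big_morph (fun f : Ind => sec f g)). Qed.

Lemma sec_borel f x y z g :
  sec f (borel x y z * g)%g = uval (theta1 x) * uval (theta2 y) * sec f g.
Proof. by case: f => f /=; case/asboolP. Qed.

Lemma sec_near1 f :
  exists m, forall h g, near1 m h -> sec f (g * h)%g = sec f g.
Proof.
case: f => f /=; case/asboolP=> _ [K [Ko fK]].
have [m Hm] := open_subgroup_near1 Ko; exists m => h g /Hm; exact: fK.
Qed.

Lemma sec_vanish f (g g' : G) y :
    uval g' 1 0 = y * uval g 1 0 -> uval g' 1 1 = y * uval g 1 1 ->
  sec f g = 0 -> sec f g' = 0.
Proof.
move=> g'0 g'1 fg; have [x [y' [z ->]]] := borel_orbit g'0 g'1.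
by rewrite sec_borel fg mulr0.
Qed.

Lemma sec_cut (f : Ind) (W : G -> Prop) m :
    (forall x y z g, W (borel x y z * g)%g <-> W g) ->
    (forall h g, near1 m h -> (W (g * h)%g <-> W g)) ->
  exists f' : Ind, forall g, sec f' g = if `[< W g >] then sec f g else 0.
Proof.
move=> W_borel W_m; pose phi g := if `[< W g >] then sec f g else 0.
suff phiP : (phi : trans_rep F k) \in ind_pred theta1 theta2 by exists (Submod phiP).
apply/asboolP; split=> [x y z g|].
  rewrite /phi (asbool_equiv_eq (W_borel x y z g)) sec_borel.
  by case: asboolP; rewrite ?mulr0.
have [n Hn] := sec_near1 f.
apply: (@near1_open_subgroup _ _ _ _ _ (maxn m n)) => h g hmn.
have hm : near1 m h by apply: mx_ballS hmn; apply: leq_maxl.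
have hn : near1 n h by apply: mx_ballS hmn; apply: leq_maxr.
by rewrite /phi (asbool_equiv_eq (W_m h g hm)) Hn.
Qed.

(** If the slope of [g] has an inverse [s] that is small, then [g] and [lower s]
    lie in the same Borel orbit, and [f] takes the same value at [lower s] as at
    1.  By [ext_ballV] the other slopes are bounded. *)
Lemma sec_bounded f : sec f 1%g = 0 ->
  exists R, forall g, sec f g != 0 -> slope_in (fun t => ball 0 (t *+ p ^ R)) g.
Proof.
move=> f1; have [m Hm] := sec_near1 f; have [R HR] := ext_ballV F m.
exists R => g fg; split.
  apply: contra_neq fg => g10; apply: (@sec_vanish _ 1%g _ (uval g 1 1)) => //.
    by rewrite GL2_1_10 mulr0.
  by rewrite GL2_1_11 mulr1.
have [->|g11] := eqVneq (uval g 1 1) 0.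
  by rewrite mul0r mul0rn; apply: ext_ball0.
rewrite -invf_div; apply: HR => /near1_lower/(Hm _ 1%g).
rewrite mul1g f1; move/eqP: fg => fg low0; apply: fg.
apply: sec_vanish low0; rewrite ?lower10 ?lower11; last exact: esym (mulr1 _).
by rewrite mulrC divfK.
Qed.

(** Here [f'] is [f] restricted to the slopes in the set [D] of [ext_tiling].
    As [f] is invariant under the [unip (c *+ i)], the value at [g] of the
    [i]-th summand is [f g] if the slope of [g] translated by [c *+ i] lies in
    [D], and 0 otherwise; the first case occurs for exactly one [i]. Bounded
    support ensures that this restriction is smooth. *)
Lemma sec_tiling f m : sec f 1%g = 0 ->
  exists c f', ball m c /\ f = \sum_(i < p) act Ind (unip (c *+ i)) f'.
Proof.
move=> f1; have [R f_bd] := sec_bounded f1; have [n f_n] := sec_near1 f.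
have [c [D [c_mn D_ball D_tile]]] := ext_tiling F (maxn m n).
pose S t := ball 0 (t *+ p ^ R) /\ D t.
have [||N SN] := @slope_in_near1 _ _ _ S R (maxn m n).+1; first by move=> t [].
  move=> t t' [tR Dt] tt'; split; last exact: D_ball Dt tt'.
  rewrite -(subrK t t') mulrnDl; apply: ext_ballD => //; apply: ext_ballMn.
  exact: ext_ballS tt'.
have [f' f'E] := sec_cut f (slope_in_borel S) SN.
exists c, f'; split; first by apply: ext_ballS c_mn; apply: leq_maxl.
apply: sec_inj => g; rewrite sec_sum.
have fc i : sec f (g * unip (c *+ i))%g = sec f g.
  by apply/f_n/near1_unip/ext_ballMn; apply: ext_ballS c_mn; apply: leq_maxr.
have [fg|fg] := eqVneq (sec f g) 0.
  by rewrite fg big1 // => i _; rewrite sec_act f'E fc fg; case: ifP.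
have [g10 _] := f_bd _ fg.
have [j Hj] := D_tile (uval g 1 1 / uval g 1 0).
have f'i (i : 'I_p) : sec f' (g * unip (c *+ i))%g = if i == j then sec f g else 0.
  rewrite f'E fc; congr (if _ then _ else _); apply/asboolP/eqP => [[_ [_ ]]|].
    by rewrite slope_unip // => /Hj.
  move=> /Hj Di; have [|gc0] := f_bd (g * unip (c *+ i))%g; first by rewrite fc.
  by split=> //; split=> //; rewrite slope_unip.
rewrite (bigD1 j) // big1; last first.
  by move=> i /andP[_ ij]; rewrite sec_act f'i (negPf ij).
by rewrite sec_act f'i eqxx; apply/esym/addr0.
Qed.

(** The second summand vanishes at the slope 1 because the first one is [f]
    restricted to a bounded set of slopes that contains 1. *)
Lemma sec_split f : exists f1 f2 : Ind,
  [/\ f = f1 + f2, sec f1 1%g = 0 & sec f2 (lower 1) = 0].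
Proof.
have [R one_R] := ext_ball_absorb 0 (1 : F).
pose S t := ball 0 (t *+ p ^ R).
have [||m Sm] := @slope_in_near1 _ _ _ S R 0%N; first by [].
  move=> t t' tR tt'; rewrite /S -(subrK t t') mulrnDl; apply: ext_ballD => //.
  exact: ext_ballMn.
have [f1 f1E] := sec_cut f (slope_in_borel S) Sm.
exists f1, (f - f1); split; first by rewrite addrC subrK.
  by rewrite f1E asboolF // => -[]; rewrite GL2_1_10 eqxx.
rewrite secB f1E asboolT ?subrr //; split; rewrite lower10 ?oner_eq0 //.
by rewrite lower11 divr1.
Qed.

End InducedSections.

(** * Invariant forms on tensor products *)

Lemma linear_bundle (R : pzRingType) (U V : lmodType R) (h : U -> V) :
  linear h -> exists L : {linear U -> V}, L =1 h.
Proof.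
move=> h_lin; pose m := GRing.isLinear.Build _ _ _ _ h h_lin.
by exists (HB.pack_for {linear U -> V} h m).
Qed.

Section TensorSpan.
Variables (k : fieldType) (G : groupType) (I : finType) (rho : I -> rep k G).

(** A tensor is the class of a finitely supported function, hence of a finite
    combination of basis vectors; the proof removes the points of the support
    one by one. *)
Lemma tensor_span (S : {pred tensor_rep rho}) : submod_closed S ->
  (forall x, (pure_tensor x : tensor_rep rho) \in S) -> forall v, v \in S.
Proof.
move=> S_sub S_pure v; have [w ->] := quotpi_surj v.
have : finite_set [set x | (submod_val w : _ -> k^o) x != 0]%classic.
  by case: w => w /= /asboolP.
move=> /(finite_seqP (T := {classic forall i, rho i}))[s sE].
have {sE} : forall x : {classic forall i, rho i},
    (submod_val w : _ -> k^o) x != 0 -> x \in s.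
  by move=> x wx; have : [set` s]%classic x by rewrite -sE.
elim: s w => [|x s IHs] w ws.
  rewrite (_ : w = 0); last first.
    by apply/val_inj/funext => x; apply/eqP/negPn/negP => /ws.
  case: S_sub => S0 _; rewrite (_ : quotpi _ _ = 0) //.
  by have := quotpi_linear (span_pred (@multilinear_rel _ _ _ rho)) (-1) 0 0;
    rewrite scaler0 addr0 scaleN1r addNr.
pose a := (submod_val w : _ -> k^o) x.
rewrite -[w](subrK (a *: delta x)) addrC.
rewrite quotpi_linear; apply: S_sub.2; first exact: S_pure.
apply: IHs => y.
rewrite [_ y](_ : _ = (submod_val w : _ -> k^o) y - a * (`[< y = x >])%:R) //.
have [->|yx] := pselect (y = x); first by rewrite asboolT // mulr1 subrr eqxx.
rewrite asboolF // mulr0 subr0 => /ws; rewrite inE => /orP[/eqP//|]; exact.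
Qed.

End TensorSpan.

Section Main.
Variables (p : nat) (p_pr : prime p) (F : fieldExtType (padic p_pr)) (k : fieldType).
Local Notation G := (GL2 F).

(** Equivariance under SL_2 makes it possible to disregard twists by characters
    of the determinant. *)
Definition SL2_equivariant (rho sigma : rep k G) (q : rho -> sigma) :=
  forall g v, GL2_det g = 1%g -> q (act rho g v) = act sigma g (q v).

Definition smooth (rho : rep k G) := forall v : rho, exists K,
  open_subgroup (@GL2_open _ _ F) K /\ fixed_by K v.

Section Forms.
Variables (I : finType) (rho : I -> rep k G) (i0 : I).
Variables (theta1 theta2 : {multiplicative Fx F -> kx k}).
Variables (q : {linear ind_rep theta1 theta2 -> rho i0}).
Variable Phi : (forall i, rho i) -> k^o.
Hypotheses (p0 : p%:R = 0 :> k) (rho_smooth : forall i, smooth (rho i)).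
Hypothesis q_equiv : SL2_equivariant q.
Hypothesis Phi_linear : forall x, linear (fun u : rho i0 => Phi (dfwith x u)).
Hypothesis Phi_invariant : forall g x,
  GL2_det g = 1%g -> Phi (pointwise_act g x) = Phi x.

(** The [p] translates of the section given by [sec_tiling] have the same image
    under the form, so that their sum has image 0 in characteristic [p]. *)
Lemma form_vanish_at_infinity x f : sec f 1%g = 0 -> Phi (dfwith x (q f)) = 0.
Proof.
move=> f1.
have [i|i m n le_mn Hm h hn|m Hm] := @fin_bound _ (fun i m => forall h : G,
    near1 m h -> act (rho i) h (x i) = x i).
- have [K [Ko Kx]] := rho_smooth (x i); have [m Hm] := open_subgroup_near1 Ko.
  by exists m => h /Hm; apply: Kx.
- by apply: Hm; apply: mx_ballS hn.
have [c [f' [cm ->]]] := sec_tiling m f1.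
have [L LE] := linear_bundle (Phi_linear x).
rewrite -LE !linear_sum /= (eq_bigr (fun=> L (q f'))) => [|i _].
  by rewrite sumr_const card_ord -mulr_natr p0 mulr0.
rewrite q_equiv ?det_unip // !LE -[RHS](Phi_invariant _ (det_unip (c *+ i))).
rewrite pointwise_act_dfwith (_ : pointwise_act _ x = x) //.
apply: functional_extensionality_dep => j.
by apply/Hm/near1_unip/ext_ballMn.
Qed.

Lemma form_vanish x f : Phi (dfwith x (q f)) = 0.
Proof.
have [f1 [f2 [-> f11 f2w]]] := sec_split f.
have [L LE] := linear_bundle (Phi_linear x).
rewrite -LE !linearD !LE form_vanish_at_infinity // add0r.
rewrite -(Phi_invariant _ (det_lower 1)) pointwise_act_dfwith -q_equiv ?det_lower //.
by apply: form_vanish_at_infinity; rewrite sec_act mul1g.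
Qed.

End Forms.

Lemma principal_quotient (rho : rep k G) : principal_series rho ->
  exists (theta1 theta2 : {multiplicative Fx F -> kx k})
    (q : {linear ind_rep theta1 theta2 -> rho}),
  SL2_equivariant q /\ forall v, exists f, v = q f.
Proof.
move=> [theta1 [theta2 [_ _ _ [phi [[psi phiK psiK] phi_equiv]]]]].
have [q qE] := linear_bundle (can2_linear phiK psiK).
exists theta1, theta2, q; split=> [g f _|v].
  by rewrite !qE; apply: (can_inj phiK); rewrite phi_equiv !psiK.
by exists (phi v); rewrite qE phiK.
Qed.

Section Special.
Variable theta : {multiplicative Fx F -> kx k}.
Local Notation Sp := (Sp F k).
Local Notation chi := (char_rep (theta \o @GL2_det _ _ F)).
Local Notation rho := (fun b : bool => if b then Sp else chi).

Definition tpair (v : Sp) (c : k^o) : forall b : bool, rho b :=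
  fun b => if b return rho b then v else c.

Definition pure2 (v : Sp) (c : k^o) : tensor2_rep Sp chi := pure_tensor (tpair v c).

Lemma pure2_linearl c : linear (pure2^~ c).
Proof.
have E v : pure2 v c = pure_tensor (dfwith (tpair 0 c) (v : rho true)).
  congr pure_tensor; apply: functional_extensionality_dep => -[].
    by rewrite dfwith_in.
  by rewrite dfwith_out.
by move=> a u v; rewrite !E pure_tensor_linear.
Qed.

Lemma pure2_linearr v : linear (pure2 v).
Proof.
have E c : pure2 v c = pure_tensor (dfwith (tpair v 0) (c : rho false)).
  congr pure_tensor; apply: functional_extensionality_dep => -[].
    by rewrite dfwith_out.
  by rewrite dfwith_in.
by move=> a u c; rewrite !E pure_tensor_linear.
Qed.

Lemma act_pure2 g v c :
  act (tensor2_rep Sp chi) g (pure2 v c) = pure2 (act Sp g v) (act chi g c).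
Proof.
rewrite /pure2 act_pure_tensor; congr pure_tensor.
by apply: functional_extensionality_dep => -[].
Qed.

Lemma pure2_surj w : exists v, w = pure2 v 1.
Proof.
suff : w \in [pred w | `[< exists v, w = pure2 v 1 >]] by move/asboolP.
apply: tensor_span => [|x]; last first.
  apply/asboolP; exists ((x false : k^o) *: (x true : Sp)).
  have [l lE] := linear_bundle (pure2_linearl (1 : k^o)).
  have [r rE] := linear_bundle (pure2_linearr (x true)).
  rewrite -lE linearZ /= lE -rE -linearZ /= rE /pure2.
  congr pure_tensor; apply: functional_extensionality_dep => -[] //=.
  by rewrite [RHS]mulr1.
have [l lE] := linear_bundle (pure2_linearl (1 : k^o)).
split=> [|a u v]; first by apply/asboolP; exists 0; rewrite -lE linear0.
move=> /asboolP[x ->] /asboolP[y ->]; apply/asboolP.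
by exists (a *: x + y); rewrite -!lE linearP.
Qed.

End Special.

(** The twist is trivial on SL_2, so that [f] in [Ind 1] maps equivariantly to
    the tensor product of its class in [Sp] with the vector 1; any tensor has the
    form [v (x) 1], since the second factor is a line. *)
Lemma special_quotient (rho : rep k G) : special_series rho ->
  exists (theta1 theta2 : {multiplicative Fx F -> kx k})
    (q : {linear ind_rep theta1 theta2 -> rho}),
  SL2_equivariant q /\ forall v, exists f, v = q f.
Proof.
move=> [theta [_ [phi [[psi phiK psiK] phi_equiv]]]].
have [psil psilE] := linear_bundle (can2_linear phiK psiK).
have [l lE] := linear_bundle (@pure2_linearl theta 1).
have [pil pilE] := linear_bundle (quotpi_linear (@const_pred p p_pr F k)).
exists (@one_char _ _ F k), (@one_char _ _ F k), (psil \o l \o pil)%FUN.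
split=> [g f g1|v] /=.
  rewrite !psilE !lE !pilE; apply: (can_inj phiK); rewrite phi_equiv !psiK.
  rewrite act_pure2; congr pure2.
    exact: (esym (quot_act_pi (@const_stable _ _ F k) g f)).
  rewrite /= (_ : theta _ = 1%g) /= ?scale1r //.
  by rewrite g1; apply: (@mulgI _ (theta 1%g)); rewrite -gmulfM !mulg1.
have [w wE] := pure2_surj (phi v); have [f fE] := quotpi_surj w.
by exists f; rewrite psilE lE pilE -fE -wE phiK.
Qed.

End Main.

Theorem theorem1p3 (p : nat) (p_pr : prime p) (F : fieldExtType (padic p_pr))
    (k : closedFieldType) (iota : {rmorphism 'F_p -> k})
    (k_alg : integralRange iota)
    (n : nat) (n_gt0 : (0 < n)%N) (pi : 'I_n -> rep k (GL2 F))
    (pi_irr : forall i, irreducible (pi i))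
    (pi_adm : forall i, admissible (@GL2_open _ _ F) (pi i))
    (pi_series : forall i, principal_series (pi i) \/ special_series (pi i))
    (f : {linear tensor_rep pi -> triv_rep k (GL2 F)}) :
  equivariant f -> forall v, f v = 0.
Proof.
move=> f_equiv v; pose i0 := Ordinal n_gt0.
suff : v \in [pred v | f v == 0] by move/eqP.
apply: tensor_span => [|x].
  split=> [|a u w /eqP fu /eqP fw]; apply/eqP; first exact: linear0.
  by rewrite linearP fu fw scaler0 addr0.
have p0 : p%:R = 0 :> k.
  by rewrite -(rmorph_nat iota) (pcharf0 (pchar_Fp p_pr)) rmorph0.
have [theta1 [theta2 [q [q_equiv q_surj]]]] :
    exists (theta1 theta2 : {multiplicative Fx F -> kx k})
      (q : {linear ind_rep theta1 theta2 -> pi i0}),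
    SL2_equivariant q /\ forall v, exists f, v = q f.
  by case: (pi_series i0); [apply: principal_quotient | apply: special_quotient].
have [s xE] := q_surj (x i0); apply/eqP.
have -> : x = dfwith x (q s).
  apply: functional_extensionality_dep => i; rewrite -xE.
  by case: (dfwithP x (x i0)).
pose Phi x : k^o := f (pure_tensor x).
apply: (@form_vanish _ _ _ _ _ _ _ _ _ _ Phi p0 _ q_equiv) => [i w|y a u w|g y _].
- exact: (pi_adm i).1.
- by rewrite /Phi pure_tensor_linear linearP.
by rewrite /Phi -act_pure_tensor f_equiv.
Qed.
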